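(* Let $\mathbb{F}$ be a field, let $P$ be the lattice of multiset subsets of $\hat 1=\prod_{i=1}^l x_i^{n_i}$ and let $\Delta$ be a multicomplex in $P$ with $\hat 1\notin\Delta$. Let $X=X(\Delta)$ be the set of all meets of facets of $\Delta$, let $\mathfrak{A}$ be the associated sheaf of rings on $X$, and let $I_\Delta$ be the ideal of $\mathbb{F}[x_1,\dots,x_l]$ generated by the monomials corresponding to the elements of $P\setminus\Delta$. Then the ring of sections on $X$ is isomorphic to the quotient of the polynomial ring by $I_\Delta$, i.e. $$\Gamma(\mathfrak{A})\simeq\mathbb{F}[x_1,\dots,x_l]/I_\Delta .$$
   Context: $P$ is the set of monomials $\prod_{i=1}^l x_i^{a_i}$ with $0\le a_i\le n_i$ (identified with multisets), ordered by divisibility (multiset inclusion $\subseteq$); the meet is the gcd; $v_{x_i}(\prod_j x_j^{a_j})=a_i$. A multicomplex $\Delta$ in $P$ is a non-empty subset of $P$ closed under taking divisors; its facets are its maximal elements. $X=X(\Delta)$ is the set of all meets of facets of $\Delta$, made into a poset by $A\preceq B$ iff $B\subseteq A$. For $\sigma\in X$ the stalk is $$(\mathfrak{A})_\sigma=\mathbb{F}[x_1,\dots,x_l]/(x_1^{v_{x_1}(\sigma)+1},\dots,x_l^{v_{x_l}(\sigma)+1}),$$ and for $\sigma\preceq\tau$ in $X$ (i.e. $\tau\subseteq\sigma$), $\rho_{\tau\sigma}:(\mathfrak{A})_\sigma\to(\mathfrak{A})_\tau$ is the natural projection. The ring of sections is $$\Gamma(\mathfrak{A})=\Big\{(f_\sigma)_{\sigma\in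 X}\in\prod_{\sigma\in X}(\mathfrak{A})_\sigma:\ \rho_{\tau\sigma}(f_\sigma)=f_\tau\ \text{for all }\sigma\preceq\tau\text{ in }X\Big\}.$$
   Formalization: The claim fails if some x_i^{n_i} lies in Δ (e.g. Δ={1,x} in P of xy). Proved: Γ(𝔄) ≅ F[x_1,…,x_l]/(I_Δ + (x_1^{n_1+1},…,x_l^{n_l+1})) always, and Γ(𝔄) ≅ F[x_1,…,x_l]/I_Δ when no x_i^{n_i} is in Δ. *)

(* Defs.v *)
From HB Require Import structures.
From mathcomp Require Import all_boot all_order all_algebra.
From mathcomp Require Import boolp.
From mathcomp Require Export mpoly.

Set Implicit Arguments.
Unset Strict Implicit.
Unset Printing Implicit Defensive.

Import Order.TTheory GRing.Theory.
Local Open Scope ring_scope.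
Local Open Scope quotient_scope.

Definition ring_isomorphic (A B : pzRingType) : Prop :=
  exists f : {rmorphism A -> B}, bijective f.

Fact submset_display : Order.disp_t. Proof. exact: Order.Disp tt tt. Qed.

(* The lattice of the divisors of the monomial n, that is, of the multisets    *)
(* contained in n, ordered by divisibility.                                    *)
Section SubMultisets.
Variables (l : nat) (n : 'X_{1..l}).

Record submset := SubMset { mset_val :> 'X_{1..l}; _ : (mset_val <= n)%MM }.

HB.instance Definition _ := [isSub for mset_val].
HB.instance Definition _ := [Countable of submset by <:].

Lemma submset_le (A : submset) (i : 'I_l) : (A i <= n i)%N.
Proof. by case: A => A /= /mnm_lepP. Qed.

Definition submset_code (A : submset) : {dffun forall i : 'I_l, 'I_(n i).+1} :=
  [ffun i => Ordinal (submset_le A i : A i < (n i).+1)%N].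

Fact submset_decode_subproof (f : {dffun forall i : 'I_l, 'I_(n i).+1}) :
  ([multinom (f i : nat) | i < l] <= n)%MM.
Proof. by apply/mnm_lepP => i; rewrite mnmE -ltnS. Qed.

Definition submset_decode f := SubMset (submset_decode_subproof f).

Lemma submset_codeK : cancel submset_code submset_decode.
Proof.
by move=> A; apply/val_inj/mnmP => i; rewrite /= mnmE /submset_code ffunE.
Qed.

HB.instance Definition _ : isFinite submset := CanIsFinite submset_codeK.

Definition mset_le (A B : submset) := (A <= B)%MM.
Definition mset_lt (A B : submset) := (B != A) && mset_le A B.

Fact mset_meet_subproof (A B : submset) :
  ([multinom minn (A i) (B i) | i < l] <= n)%MM.
Proof.
by apply/mnm_lepP => i; rewrite mnmE geq_min submset_le.
Qed.

Fact mset_join_subproof (A B : submset) : (mlcm A B <= n)%MM.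
Proof. by rewrite lem_mlcm (valP A) (valP B). Qed.

Definition mset_meet A B := SubMset (mset_meet_subproof A B).
Definition mset_join A B := SubMset (mset_join_subproof A B).

Let msetP (A B : submset) : (forall i, A i = B i) -> A = B.
Proof. by move=> eqAB; apply/val_inj/mnmP. Qed.

Let meetE A B i : mset_meet A B i = minn (A i) (B i).
Proof. exact: mnmE. Qed.
Let joinE A B i : mset_join A B i = maxn (A i) (B i).
Proof. exact: mnmE. Qed.

Fact mset_le_def A B : mset_le A B = (mset_meet A B == A).
Proof.
apply/mnm_lepP/eqP => [leAB | <- i]; last by rewrite meetE geq_minr.
by apply: msetP => i; rewrite meetE; apply/minn_idPl.
Qed.

Fact mset_lt_def A B : mset_lt A B = (B != A) && mset_le A B.
Proof. by []. Qed.
Fact mset_meetC : commutative mset_meet.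
Proof. by move=> A B; apply: msetP => i; rewrite !meetE minnC. Qed.
Fact mset_joinC : commutative mset_join.
Proof. by move=> A B; apply: msetP => i; rewrite !joinE maxnC. Qed.
Fact mset_meetA : associative mset_meet.
Proof. by move=> A B C; apply: msetP => i; rewrite !meetE minnA. Qed.
Fact mset_joinA : associative mset_join.
Proof. by move=> A B C; apply: msetP => i; rewrite !joinE maxnA. Qed.
Fact mset_joinKI (B A : submset) : mset_meet A (mset_join A B) = A.
Proof. by apply: msetP => i; rewrite meetE joinE maxnC maxKn. Qed.
Fact mset_meetKU (B A : submset) : mset_join A (mset_meet A B) = A.
Proof. by apply: msetP => i; rewrite joinE meetE minnC minKn. Qed.
Fact mset_meetUl : left_distributive mset_meet mset_join.
Proof.
by move=> A B C; apply: msetP => i; rewrite !(joinE, meetE) minn_maxl.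
Qed.
Fact mset_meetxx : idempotent_op mset_meet.
Proof. by move=> A; apply: msetP => i; rewrite meetE minnn. Qed.

HB.instance Definition _ := Order.isMeetJoinDistrLattice.Build
  submset_display submset mset_le_def mset_lt_def mset_meetC mset_joinC
  mset_meetA mset_joinA mset_joinKI mset_meetKU mset_meetUl mset_meetxx.

Fact mset_bot_subproof : (0 <= n)%MM.
Proof. by apply/mnm_lepP => i; rewrite mnm0E. Qed.
Definition mset_bot := SubMset mset_bot_subproof.
Definition mset_top := SubMset (lepm_refl n).

Fact mset_le0x A : (mset_bot <= A)%O.
Proof. by apply/mnm_lepP => i; rewrite mnm0E. Qed.
Fact mset_lex1 A : (A <= mset_top)%O.
Proof. exact: valP A. Qed.

HB.instance Definition _ :=
  Order.hasBottom.Build submset_display submset mset_le0x.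
HB.instance Definition _ :=
  Order.hasTop.Build submset_display submset mset_lex1.

Lemma submset_leE (A B : submset) : (A <= B)%O = (mset_val A <= mset_val B)%MM.
Proof. by []. Qed.

End SubMultisets.

Section Multicomplexes.
Variables (l : nat) (n : 'X_{1..l}).

Record multicomplex := Multicomplex {
  mcx_set :> {set submset n};
  mcx_neq0 : mcx_set != set0;
  mcx_closed : forall A B : submset n,
    B \in mcx_set -> (A <= B)%O -> A \in mcx_set }.

Variable Delta : multicomplex.

Lemma mcx_bot : (\bot : submset n)%O \in (Delta : {set _}).
Proof.
by have /set0Pn[A DA] := mcx_neq0 Delta; apply: mcx_closed DA (le0x _).
Qed.

Definition facets : {set submset n} :=
  [set A in (Delta : {set _}) |
     [forall B in (Delta : {set _}), (A <= B)%O ==> (A == B)]].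

(* Meets of nonempty families only: the empty meet would be n itself.          *)
Definition facet_meets : {set submset n} :=
  [set s | [exists S : {set submset n},
     [&& S \subset facets, S != set0 & s == (\meet_(A in S) A)%O]]].

Definition meetX := {s : submset n | s \in facet_meets}.

Definition meetX_le (s t : meetX) : bool := (val t <= val s)%O.

End Multicomplexes.

(* Ideals of F[x_1, ..., x_l] generated by monomials.  The generating set      *)
(* does not contain 1, so that the ideal is proper, which {ideal_quot _}       *)
(* requires.                                                                   *)
Record mgens (l : nat) := MGens {
  mgens_pred :> pred 'X_{1..l};
  mgens0 : ~~ mgens_pred 0%MM }.

Section MonomialIdeals.
Variables (F : fieldType) (l : nat).

Definition mideal (G : mgens l) : {pred {mpoly F[l]}} :=
  fun p => `[< exists s : seq ({mpoly F[l]} * 'X_{1..l}),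
    all G (unzip2 s) /\ p = \sum_(t <- s) t.1 * 'X_[t.2] >].

Lemma midealP (G : mgens l) (p : {mpoly F[l]}) :
  reflect (exists s : seq ({mpoly F[l]} * 'X_{1..l}),
             all G (unzip2 s) /\ p = \sum_(t <- s) t.1 * 'X_[t.2])
          (p \in mideal G).
Proof. exact: asboolP. Qed.

Fact mideal_closed (G : mgens l) : idealr_closed (mideal G).
Proof.
split.
- by apply/midealP; exists [::]; rewrite big_nil.
- apply/negP => /midealP[s [Gs /(congr1 (mcoeff 0))]].
  rewrite mcoeff1 eqxx raddf_sum /= big_seq big1 => [/eqP|t st].
    by rewrite oner_eq0.
  have Gt : G t.2 by apply: (allP Gs); apply: map_f.
  rewrite (rmorphM (mcoeff 0%MM)) /= mcoeffX; case: eqP => [t0|_].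
    by have := mgens0 G; rewrite -t0 Gt.
  by rewrite mulr0.
- move=> a p q /midealP[s [Gs ->]] /midealP[t [Gt ->]]; apply/midealP.
  exists ([seq (a * u.1, u.2) | u <- s] ++ t); split.
    by rewrite /unzip2 map_cat all_cat -map_comp; apply/andP.
  rewrite big_cat big_map mulr_sumr; congr (_ + _).
  by apply: eq_bigr => u _; rewrite mulrA.
Qed.

HB.instance Definition _ (G : mgens l) :=
  isIdealr.Build {mpoly F[l]} (mideal G) (mideal_closed G).

Definition mquot (G : mgens l) := {ideal_quot (mideal G)}.
HB.instance Definition _ (G : mgens l) := GRing.ComNzRing.on (mquot G).
HB.instance Definition _ (G : mgens l) := Quotient.on (mquot G).

Lemma mquot_eqP (G : mgens l) (p q : {mpoly F[l]}) :
  reflect (\pi_(mquot G) p = \pi_(mquot G) q) (p - q \in mideal G).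
Proof. by rewrite Quotient.idealrBE; apply: eqP. Qed.

Lemma mideal_sub (G H : mgens l) :
  (forall m, G m -> 'X_[m] \in mideal H) -> {subset mideal G <= mideal H}.
Proof.
move=> GH p /midealP[s [Gs ->]]; rewrite big_seq; apply: rpred_sum => t st.
by apply: idealMr; apply: GH; apply: (allP Gs); apply: map_f.
Qed.

Lemma mideal_gen (G : mgens l) m : G m -> 'X_[m] \in mideal G.
Proof.
move=> Gm; apply/midealP; exists [:: (1, m)]; rewrite /= Gm big_seq1 mul1r.
by [].
Qed.

End MonomialIdeals.

Arguments mideal F {l} G.
Arguments mquot F {l} G.

Section Generators.
Variable l : nat.

Fact power_gens_subproof (m : 'X_{1..l}) :
  ~~ [exists i : 'I_l, (0 == U_(i) *+ (m i).+1 :> 'X_{1..l})%MM].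
Proof.
apply/existsPn => i; apply/eqP => /mnmP/(_ i).
by rewrite mnm0E mulmnE mnm1E eqxx mul1n.
Qed.

(* x_1^(m_1 + 1), ..., x_l^(m_l + 1) *)
Definition power_gens (m : 'X_{1..l}) : mgens l :=
  @MGens l (fun u => [exists i : 'I_l, u == (U_(i) *+ (m i).+1)%MM])
    (power_gens_subproof m).

Fact mgensU_subproof (G H : mgens l) : ~~ (G 0%MM || H 0%MM).
Proof. by rewrite negb_or !mgens0. Qed.

Definition mgensU (G H : mgens l) : mgens l :=
  @MGens l (fun u => G u || H u) (mgensU_subproof G H).

Variables (n : 'X_{1..l}) (Delta : multicomplex n).

Fact nonface_gens_subproof :
  ~~ [exists A : submset n, (A \notin (Delta : {set _})) && (0%MM == mset_val A)].
Proof.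
apply/existsPn => A; rewrite negb_and negbK; case: eqP; last by rewrite orbT.
move=> A0; rewrite (_ : A = (\bot : submset n)%O) ?mcx_bot //.
exact: val_inj.
Qed.

(* Only monomials dividing n are generators.  Hence, if x_i^(n_i) is in Delta, *)
(* no power of x_i lies in the ideal, whereas x_i^(n_i + 1) vanishes in every  *)
(* stalk of the sheaf below.                                                   *)
Definition nonface_gens : mgens l :=
  @MGens l (fun u => [exists A : submset n,
     (A \notin (Delta : {set _})) && (u == mset_val A)])
    nonface_gens_subproof.

Fact pure_power_subproof (i : 'I_l) : (U_(i) *+ n i <= n)%MM.
Proof.
apply/mnm_lepP => j; rewrite mulmnE mnm1E; case: eqP => [->|_]; first by rewrite mul1n.
by rewrite mul0n.
Qed.

(* x_i^(n_i) *)
Definition pure_power (i : 'I_l) : submset n := SubMset (pure_power_subproof i).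

End Generators.

Section ProductRing.
Variables (I : finType) (R : I -> comPzRingType).

Definition prodring := {dffun forall i, R i}.
HB.instance Definition _ := Choice.on prodring.

Implicit Types f g : prodring.

Definition prodring0 : prodring := [ffun i => 0].
Definition prodring1 : prodring := [ffun i => 1].
Definition prodring_opp f : prodring := [ffun i => - f i].
Definition prodring_add f g : prodring := [ffun i => f i + g i].
Definition prodring_mul f g : prodring := [ffun i => f i * g i].

Fact prodring_addA : associative prodring_add.
Proof. by move=> f g h; apply/ffunP => i; rewrite !ffunE addrA. Qed.
Fact prodring_addC : commutative prodring_add.
Proof. by move=> f g; apply/ffunP => i; rewrite !ffunE addrC. Qed.
Fact prodring_add0 : left_id prodring0 prodring_add.
Proof. by move=> f; apply/ffunP => i; rewrite !ffunE add0r. Qed.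
Fact prodring_addN : left_inverse prodring0 prodring_opp prodring_add.
Proof. by move=> f; apply/ffunP => i; rewrite !ffunE addNr. Qed.

HB.instance Definition _ := GRing.isZmodule.Build prodring
  prodring_addA prodring_addC prodring_add0 prodring_addN.

Fact prodring_mulA : associative prodring_mul.
Proof. by move=> f g h; apply/ffunP => i; rewrite !ffunE mulrA. Qed.
Fact prodring_mulC : commutative prodring_mul.
Proof. by move=> f g; apply/ffunP => i; rewrite !ffunE mulrC. Qed.
Fact prodring_mul1 : left_id prodring1 prodring_mul.
Proof. by move=> f; apply/ffunP => i; rewrite !ffunE mul1r. Qed.
Fact prodring_mulDl : left_distributive prodring_mul prodring_add.
Proof. by move=> f g h; apply/ffunP => i; rewrite !ffunE mulrDl. Qed.

HB.instance Definition _ := GRing.Zmodule_isComPzRing.Build prodring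
  prodring_mulA prodring_mulC prodring_mul1 prodring_mulDl.

Lemma prodring1E i : (1 : prodring) i = 1.
Proof. exact: ffunE. Qed.
Lemma prodringBE f g i : (f - g) i = f i - g i.
Proof. by rewrite ffunE ffunE. Qed.
Lemma prodringME f g i : (f * g) i = f i * g i.
Proof. exact: ffunE. Qed.

End ProductRing.

Section Sheaf.
Variables (F : fieldType) (l : nat) (n : 'X_{1..l}) (Delta : multicomplex n).

Local Notation X := (meetX Delta).
Local Notation Q s := (mquot F (power_gens (mset_val (val s)))).

Definition stalk (s : X) : comPzRingType := Q s.

(* The map is total in s and t; it is the natural projection when s precedes   *)
(* t, i.e. when t divides s (restr_pi), the only case in which it is used.     *)
Definition restr (s t : X) (f : stalk s) : stalk t := \pi_(Q t) (repr (f : Q s)).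

Lemma restr_pi (s t : X) (p : {mpoly F[l]}) : meetX_le s t ->
  restr t (\pi_(Q s) p : stalk s) = \pi_(Q t) p.
Proof.
move=> /mnm_lepP le_ts; apply/mquot_eqP.
have sub : {subset mideal F (power_gens (mset_val (val s)))
              <= mideal F (power_gens (mset_val (val t)))}.
  apply: mideal_sub => m /existsP[i /eqP->].
  have -> : (U_(i) *+ (val s i).+1 = U_(i) *+ (val t i).+1
              + U_(i) *+ (val s i - val t i))%MM.
    by apply/mnmP => j; rewrite mnmDE !mulmnE -mulnDr addSn (subnKC (le_ts i)).
  rewrite mpolyXD mulrC idealMr //.
  by apply: mideal_gen; apply/existsP; exists i.
by apply: sub; apply/mquot_eqP; rewrite reprK.
Qed.

Fact restr_is_zmod_morphism (s t : X) : meetX_le s t ->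
  zmod_morphism (@restr s t).
Proof.
move=> st f g; rewrite -[f](@reprK _ (Q s)) -[g](@reprK _ (Q s)).
rewrite -(rmorphB (\pi_(Q s))) !restr_pi //.
exact: (rmorphB (\pi_(Q t))).
Qed.

Fact restr_is_monoid_morphism (s t : X) : meetX_le s t ->
  monoid_morphism (@restr s t).
Proof.
move=> st; split => [|f g].
  rewrite -[1](rmorph1 (\pi_(Q s))) restr_pi //.
  exact: (rmorph1 (\pi_(Q t))).
rewrite -[f](@reprK _ (Q s)) -[g](@reprK _ (Q s)).
rewrite -(rmorphM (\pi_(Q s))) !restr_pi //.
exact: (rmorphM (\pi_(Q t))).
Qed.

Definition is_section : {pred prodring stalk} :=
  fun f => [forall s : X, forall t : X, meetX_le s t ==> (restr t (f s) == f t)].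

Lemma is_sectionP (f : prodring stalk) :
  reflect (forall s t : X, meetX_le s t -> restr t (f s) = f t)
          (f \in is_section).
Proof.
apply: (iffP idP) => [/forallP fP s t st | fP].
  by have /forallP/(_ t)/implyP/(_ st)/eqP := fP s.
by apply/forallP => s; apply/forallP => t; apply/implyP => st; apply/eqP/fP.
Qed.

Fact is_section_subring_closed : subring_closed is_section.
Proof.
split.
- apply/is_sectionP => s t st; rewrite !prodring1E.
  exact: (restr_is_monoid_morphism st).1.
- move=> f g /is_sectionP fP /is_sectionP gP; apply/is_sectionP => s t st.
  by rewrite !prodringBE (restr_is_zmod_morphism st) fP // gP.
- move=> f g /is_sectionP fP /is_sectionP gP; apply/is_sectionP => s t st.
  by rewrite !prodringME (restr_is_monoid_morphism st).2 fP // gP.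
Qed.

Record sections := Section {
  section_val :> prodring stalk;
  _ : section_val \in is_section }.

HB.instance Definition _ := [isSub for section_val].
HB.instance Definition _ := [Choice of sections by <:].
HB.instance Definition _ :=
  GRing.SubChoice_isSubComPzRing.Build (prodring stalk) is_section sections
    is_section_subring_closed.

End Sheaf.

Arguments stalk F {l n Delta} s.
Arguments sections F {l n} Delta.

(* Main.v *)
From HB Require Import structures.
Require Import Defs.
From mathcomp Require Import all_boot all_order all_algebra.

(** A polynomial lies in a monomial ideal iff each monomial of its support is a
    multiple of a generator.  Hence [p] vanishes in the stalk at [s] iff no
    monomial of [p] divides [s], and [p] vanishes in every stalk iff no monomial
    of [p] is in [Delta].  Conversely, the coefficient of a monomial [m] in
    [f_s] is the same for all [s] in [X] divisible by [m], because two such [s]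
    have a meet in [X], which is again divisible by [m]; these common
    coefficients define a polynomial that restricts to [f]. *)

Import Order.TTheory GRing.Theory.

Set Implicit Arguments.
Unset Strict Implicit.
Unset Printing Implicit Defensive.
Local Open Scope ring_scope.
Local Open Scope quotient_scope.

Lemma ring_isomorphic_sym (A B : pzRingType) :
  ring_isomorphic A B -> ring_isomorphic B A.
Proof.
move=> [f [g fK gK]].
have gB : zmod_morphism g.
  by move=> x y; apply: (canLR fK); rewrite rmorphB !gK.
have gM : monoid_morphism g := can2_monoid_morphism fK gK.
pose zg := GRing.isZmodMorphism.Build B A g gB.
pose mg := GRing.isMonoidMorphism.Build B A g gM.
pose h : {rmorphism B -> A} := HB.pack g zg mg.
by exists h; exists f.
Qed.

(** * Monomial ideals and their quotients, read off coefficients *)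

Lemma mem_midealP (F : fieldType) (l : nat) (G : mgens l) (p : {mpoly F[l]}) :
  reflect (forall m, m \in msupp p -> exists2 u, G u & (u <= m)%MM)
          (p \in mideal F G).
Proof.
apply: (iffP idP) => [/midealP[s [Gs ->]] m /msupp_sum_le/flatten_mapP[t] | Gp].
  rewrite mem_filter /= => st; rewrite (perm_mem (msuppMX _ _)).
  case/mapP=> u _ ->; exists t.2; last exact: lem_addr.
  by apply: (allP Gs); apply: map_f.
rewrite (mpolyE p) big_seq; apply: rpred_sum => m /Gp[u Gu /submK <-].
by rewrite mpolyXD -mul_mpolyC mulrA idealMr ?mideal_gen.
Qed.

Lemma eq_mquotP (F : fieldType) (l : nat) (G : mgens l) (p q : {mpoly F[l]}) :
  reflect (forall m, p@_m != q@_m -> exists2 u, G u & (u <= m)%MM)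
          (\pi_(mquot F G) p == \pi_(mquot F G) q).
Proof.
apply: (iffP eqP) => [/mquot_eqP/mem_midealP H m pq | H].
  by apply: H; rewrite mcoeff_msupp mcoeffB subr_eq0.
apply/mquot_eqP/mem_midealP => m; rewrite mcoeff_msupp mcoeffB subr_eq0.
exact: H.
Qed.

(** A monomial [m] fails to divide [s] exactly when some exponent [m i] is at least [s i + 1], that
    is, when x_i^(s_i + 1) divides [m]. *)
Lemma power_gens_dvdP (l : nat) (s m : 'X_{1..l}) :
  (exists2 u, power_gens s u & (u <= m)%MM) <-> ~~ (m <= s)%MM.
Proof.
split=> [[_ /existsP[i /eqP->] /mnm_lepP/(_ i)] | ].
  rewrite mulmnE mnm1E eqxx mul1n => lt_sm.
  by apply/negP => /mnm_lepP/(_ i); rewrite leqNgt lt_sm.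
case/forallPn=> i; rewrite -ltnNge => lt_sm.
exists (U_(i) *+ (s i).+1)%MM; first by apply/existsP; exists i.
apply/mnm_lepP => j; rewrite mulmnE mnm1E.
by case: eqP => [<-|_]; rewrite ?mul1n ?mul0n.
Qed.

(** The stalk at [s] remembers the coefficients at divisors of [s] and nothing else. *)
Lemma eq_mquot_powerP (F : fieldType) (l : nat) (s : 'X_{1..l})
    (p q : {mpoly F[l]}) :
  reflect (forall m, (m <= s)%MM -> p@_m = q@_m)
          (\pi_(mquot F (power_gens s)) p == \pi_(mquot F (power_gens s)) q).
Proof.
apply: (iffP (eq_mquotP _ _ _)) => [H m ms | H m pq].
  by apply/eqP; apply: contraLR ms => /H /power_gens_dvdP.
by apply/power_gens_dvdP; apply: contra pq => /H->.
Qed.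

(** * Faces, facets and meets of facets *)

Section Faces.
Variables (l : nat) (n : 'X_{1..l}) (Delta : multicomplex n).

Lemma facet_above (A : submset n) : A \in (Delta : {set _}) ->
  exists2 B, B \in facets Delta & (A <= B)%O.
Proof.
move=> DA; pose above B := (B \in (Delta : {set _})) && (A <= B)%O.
have aboveA : above A by rewrite /above DA lexx.
(* Among the faces above [A], one of maximal degree is a facet: a face [C] containing it has no
   larger degree, so the difference has degree 0. *)
case: (arg_maxnP (fun B : submset n => mdeg B) aboveA) => B /andP[DB AB] maxB.
exists B => //; rewrite inE DB; apply/forallP => C; apply/implyP => DC.
apply/implyP => BC.
have /maxB le_CB : above C by rewrite /above DC (le_trans AB).
have CB0 : (C - B)%MM = 0%MM.
  apply/eqP; rewrite -mdeg_eq0 -leqn0 -(leq_add2r (mdeg B)) -mdegD.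
  by rewrite (submK BC).
 apply/eqP/val_inj; rewrite /= -[RHS](submK BC).
by rewrite CB0 add0m.
Qed.

(** A facet is the meet of the family consisting of itself; conversely, the meet of a nonempty
    family of facets divides one of them, hence is a face. *)
Lemma mem_mcxP (A : submset n) :
  reflect (exists s : meetX Delta, (A <= val s)%O) (A \in (Delta : {set _})).
Proof.
apply: (iffP idP) => [/facet_above[B facetB AB] | [[s /= Xs] As]].
  have XB : B \in facet_meets Delta.
    rewrite inE; apply/existsP; exists [set B].
    rewrite sub1set facetB big_set1 eqxx andbT.
    by apply/set0Pn; exists B; rewrite inE.
  by exists (exist _ B XB).
move: Xs; rewrite inE => /existsP[S /and3P[facetS /set0Pn[B SB] /eqP sE]].
have /(subsetP facetS) := SB; rewrite inE => /andP[DB _].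
apply: mcx_closed DB (le_trans As _); rewrite sE.
exact: (@meets_inf _ _ _ B (mem S) id).
Qed.

Lemma facet_meetsI (s t : submset n) :
  s \in facet_meets Delta -> t \in facet_meets Delta ->
  (s `&` t)%O \in facet_meets Delta.
Proof.
rewrite !inE => /existsP[S /and3P[facetS S0 /eqP->]].
move=> /existsP[T /and3P[facetT _ /eqP->]]; apply/existsP; exists (S :|: T).
rewrite subUset facetS facetT meets_setU eqxx andbT /=.
by rewrite -subset0 subUset negb_and subset0 S0.
Qed.

(** As [meetX_le] reverses divisibility, this is an upper bound of [s] and [t]: both stalks restrict
    to the stalk here. *)
Definition meetXI (s t : meetX Delta) : meetX Delta :=
  exist _ (val s `&` val t)%O (facet_meetsI (valP s) (valP t)).

Lemma notin_mcxP (m : 'X_{1..l}) (mn : (m <= n)%MM) :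
  (SubMset mn \notin (Delta : {set _})) <->
  (forall s : meetX Delta, ~~ (m <= mset_val (val s))%MM).
Proof.
split=> [/mem_mcxP Dm s | H]; first by apply/negP => ms; apply: Dm; exists s.
by apply/mem_mcxP => -[s ms]; case/negP: (H s).
Qed.

(** If [m] divides [n] but no element of X, it is a non-face, hence itself a generator; if it does
    not divide [n], some x_i^(n_i + 1) divides it. Conversely, every element of X is a face and
    divides [n]. *)
Lemma nonface_power_gens_dvdP (m : 'X_{1..l}) :
  (exists2 u, mgensU (nonface_gens Delta) (power_gens n) u & (u <= m)%MM) <->
  (forall s : meetX Delta, ~~ (m <= mset_val (val s))%MM).
Proof.
split=> [[u /orP[/existsP[A /andP[DA /eqP->]] | nu] um] s | H].
- apply/negP => ms; case/negP: DA; apply/mem_mcxP; exists s.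
  exact: lepm_trans um ms.
- have /power_gens_dvdP : exists2 u, power_gens n u & (u <= m)%MM by exists u.
  by apply: contra => ms; apply: lepm_trans ms (valP (val s)).
have [mn | ] := boolP (m <= n)%MM; last first.
  by move/power_gens_dvdP => [u nu um]; exists u => //; apply/orP; right.
exists m; last exact: lepm_refl.
apply/orP; left; apply/existsP; exists (SubMset mn).
by rewrite eqxx andbT; apply/notin_mcxP.
Qed.

(** Here x_i^(n_i) is already a generator and divides x_i^(n_i + 1), so adding the latter powers
    does not enlarge the ideal. *)
Lemma nonface_gens_dvdP (m : 'X_{1..l}) :
  (forall i : 'I_l, pure_power n i \notin (Delta : {set submset n})) ->
  (exists2 u, nonface_gens Delta u & (u <= m)%MM) <->
  (forall s : meetX Delta, ~~ (m <= mset_val (val s))%MM).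
Proof.
move=> DN; rewrite -nonface_power_gens_dvdP; split=> [] [u Gu um].
  by exists u => //; apply/orP; left.
case/orP: Gu => [|/existsP[i /eqP uE]]; first by exists u.
exists (pure_power n i : 'X_{1..l}).
  by apply/existsP; exists (pure_power n i); rewrite DN eqxx.
apply: lepm_trans um; rewrite uE; apply/mnm_lepP => j.
by rewrite !mulmnE leq_mul2l leqnSn orbT.
Qed.

End Faces.

(** * From polynomials to sections, and gluing back *)

Section Sections.
Variables (F : fieldType) (l : nat) (n : 'X_{1..l}) (Delta : multicomplex n).
Local Notation X := (meetX Delta).
Local Notation Q s := (mquot F (power_gens (mset_val (val s)))).

Fact section_of_subproof (p : {mpoly F[l]}) :
  ([ffun s => \pi_(Q s) p] : prodring (@stalk F _ _ Delta))
    \in @is_section F _ _ Delta.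
Proof. by apply/is_sectionP => s t st; rewrite !ffunE restr_pi. Qed.

Definition section_of (p : {mpoly F[l]}) : sections F Delta :=
  Section (section_of_subproof p).

Lemma section_ofE p s : section_val (section_of p) s = \pi_(Q s) p.
Proof. exact: ffunE. Qed.

Lemma sectionsP (f g : sections F Delta) :
  (forall s, section_val f s = section_val g s) -> f = g.
Proof. by move=> fg; apply/val_inj/ffunP. Qed.

Lemma section_valB (f g : sections F Delta) s :
  section_val (f - g) s = section_val f s - section_val g s.
Proof. by rewrite -prodringBE; congr (fun_of_fin _ s); exact: (raddfB val). Qed.

Lemma section_valM (f g : sections F Delta) s :
  section_val (f * g) s = section_val f s * section_val g s.
Proof. by rewrite -prodringME; congr (fun_of_fin _ s); exact: (rmorphM val). Qed.

Lemma section_val1 s : section_val (1 : sections F Delta) s = 1.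
Proof. by rewrite -prodring1E; congr (fun_of_fin _ s); exact: (rmorph1 val). Qed.

Fact section_of_is_zmod_morphism : zmod_morphism section_of.
Proof.
move=> p q; apply: sectionsP => s; rewrite section_valB !section_ofE.
exact: (rmorphB (\pi_(Q s))).
Qed.

Fact section_of_is_monoid_morphism : monoid_morphism section_of.
Proof.
split=> [|p q]; apply: sectionsP => s.
  by rewrite section_val1 section_ofE; exact: (rmorph1 (\pi_(Q s))).
by rewrite section_valM !section_ofE; exact: (rmorphM (\pi_(Q s))).
Qed.

Lemma section_of_eqP p q :
  section_of p = section_of q <->
  (forall m, p@_m != q@_m -> forall s : X, ~~ (m <= mset_val (val s))%MM).
Proof.
split=> [pq m pqm s | H].
  apply: contra pqm => ms; apply/eqP.
  have /eqP/eq_mquot_powerP -> // : \pi_(Q s) p = \pi_(Q s) q.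
  by rewrite -!section_ofE pq.
apply: sectionsP => s; rewrite !section_ofE; apply/eqP/eq_mquot_powerP => m ms.
by apply/eqP; apply: contraLR ms => /H.
Qed.

Variable f : sections F Delta.

(** The default 0 is harmless: it occurs only when [m] divides no element of X, and then no stalk
    sees the coefficient of [m]. *)
Definition section_coef (m : 'X_{1..l}) : F :=
  if [pick s : X | (m <= mset_val (val s))%MM] is Some s
  then (repr (section_val f s : Q s))@_m else 0.

Lemma section_coefE m (s : X) : (m <= mset_val (val s))%MM ->
  section_coef m = (repr (section_val f s : Q s))@_m.
Proof.
move=> ms; rewrite /section_coef; case: pickP => [t mt|/(_ s)];
  last by rewrite ms.
have mst : (m <= mset_val (val (meetXI s t)))%MM.
  by apply/mnm_lepP => i; rewrite mnmE leq_min (mnm_lepP ms) (mnm_lepP mt).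
(* To be used for [u] equal to [s] and to [t]: restriction to the meet preserves the coefficient of
   [m], since [m] divides the meet. *)
have restr_coef u : meetX_le u (meetXI s t) ->
    (repr (section_val f u : Q u))@_m =
    (repr (section_val f (meetXI s t) : Q (meetXI s t)))@_m.
  move=> le_u; have /is_sectionP/(_ _ _ le_u) := valP f.
  rewrite /restr -[RHS](@reprK _ (Q (meetXI s t))).
  by move/eqP/eq_mquot_powerP; apply.
by rewrite !restr_coef // /meetX_le ?leIl ?leIr.
Qed.

(** Summing over the divisors of [n] keeps the sum finite and covers every divisor of an element of
    X. *)
Definition glue : {mpoly F[l]} :=
  \sum_(A : submset n) section_coef A *: 'X_[mset_val A].

Lemma mcoeff_glue (m : 'X_{1..l}) : (m <= n)%MM -> glue@_m = section_coef m.
Proof.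
move=> mn; rewrite raddf_sum /= (bigD1 (SubMset mn)) //= big1 => [|A neA].
  by rewrite mcoeffZ mcoeffX eqxx mulr1 addr0.
rewrite mcoeffZ mcoeffX; case: eqP => [Am|]; last by rewrite mulr0.
by case/eqP: neA; apply: val_inj.
Qed.

Lemma glueK : section_of glue = f.
Proof.
apply: sectionsP => s; rewrite section_ofE -[RHS](@reprK _ (Q s)).
apply/eqP/eq_mquot_powerP => m ms.
by rewrite mcoeff_glue ?(section_coefE ms) ?(lepm_trans ms (valP (val s))).
Qed.

End Sections.

(** * The isomorphism *)

(** The hypothesis says that the ideal of [G] is the kernel of [section_of]; stated for a general
    [G], it serves both ideals of the theorem. *)
Lemma sections_isomorphic_mquot (F : fieldType) (l : nat) (n : 'X_{1..l})
    (Delta : multicomplex n) (G : mgens l) :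
  (forall m, (exists2 u, G u & (u <= m)%MM) <->
     (forall s : meetX Delta, ~~ (m <= mset_val (val s))%MM)) ->
  ring_isomorphic (sections F Delta) (mquot F G).
Proof.
move=> GP; apply: ring_isomorphic_sym.
pose g (x : mquot F G) : sections F Delta := section_of Delta (repr x).
(* One direction makes [g] independent of the representative, the other makes it injective;
   surjectivity comes from gluing. *)
have section_of_eq p q :
    (section_of Delta p = section_of Delta q) <->
    (\pi_(mquot F G) p = \pi_(mquot F G) q).
  rewrite section_of_eqP; split=> [H | /eqP/eq_mquotP H m /H /GP //].
  by apply/eqP/eq_mquotP => m /H /GP.
have g_pi p : g (\pi_(mquot F G) p) = section_of Delta p.
  by apply/section_of_eq; rewrite reprK.
have gB : zmod_morphism g.
  move=> x y; rewrite -[x]reprK -[y]reprK -rmorphB !g_pi.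
  exact: section_of_is_zmod_morphism.
have gM : monoid_morphism g.
  split=> [|x y].
    rewrite -(rmorph1 (\pi_(mquot F G))) g_pi.
    exact: (section_of_is_monoid_morphism F Delta).1.
  rewrite -[x]reprK -[y]reprK -rmorphM !g_pi.
  exact: (section_of_is_monoid_morphism F Delta).2.
pose zg := GRing.isZmodMorphism.Build (mquot F G) (sections F Delta) g gB.
pose mg := GRing.isMonoidMorphism.Build (mquot F G) (sections F Delta) g gM.
pose h : {rmorphism mquot F G -> sections F Delta} := HB.pack g zg mg.
exists h; exists (fun f => \pi_(mquot F G) (glue f)) => [x | f] /=.
  by rewrite -[RHS]reprK; apply/section_of_eq; rewrite glueK.
by rewrite g_pi glueK.
Qed.

(** If x_i^(n_i) is a face, x_i^(n_i + 1) vanishes in every stalk but is not in the ideal generated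
    by the non-faces dividing [n]. The first part adds these powers as generators; the second treats
    the ideal of the non-faces alone when each x_i^(n_i) is a non-face. *)
Theorem theorem55 (F : fieldType) (l : nat) (n : 'X_{1..l})
    (Delta : multicomplex n) :
  (\top : submset n)%O \notin (Delta : {set submset n}) ->
  ring_isomorphic (sections F Delta)
    (mquot F (mgensU (nonface_gens Delta) (power_gens n)))
  /\ ((forall i : 'I_l, pure_power n i \notin (Delta : {set submset n})) ->
      ring_isomorphic (sections F Delta) (mquot F (nonface_gens Delta))).
Proof.
move=> _; split=> [|DN]; apply: sections_isomorphic_mquot => m.
  exact: nonface_power_gens_dvdP.
exact: nonface_gens_dvdP.
Qed.
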